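(* Let $\|\cdot\|$ be a norm on $\mathbb{R}^2$ which is of class $C^2$ on $\mathbb{R}^2\setminus\{0\}$ and whose unit sphere $S=\{x\in\mathbb{R}^2:\|x\|=1\}$ has strictly positive curvature at every point. Then $X=(\mathbb{R}^2,\|\cdot\|)$ is uniformly micro-semitransitive: for every $\varepsilon>0$ there exists $\delta>0$ such that whenever $x,y\in S$ satisfy $\|x-y\|<\delta$ there is an invertible linear map $T:X\to X$ with $\|T\|\le 1$, $Tx=y$ and $\|T-\mathbf{I}_X\|<\varepsilon$.
   Context: All spaces are real. For a linear map $T:X\to X$, $\|T\|=\sup_{\|x\|\le 1}\|T(x)\|$ is the operator norm, and $\mathbf{I}_X$ is the identity of $X$. Curvature refers to the usual Euclidean norm $\|\cdot\|_2$: if $\Sigma$ is a parametrization of the curve $S$ by (Euclidean) arc length and $x=\Sigma(t)$, the curvature of $S$ at $x$ is $\varkappa(S,x)=\|\Sigma''(t)\|_2$. *)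

(* Defs.v *)
From Stdlib Require Import Reals.
From Coquelicot Require Import Coquelicot.
Open Scope R_scope.

(* The canonical [norm] of this product is the Euclidean norm
   [sqrt (norm u ^ 2 + norm v ^ 2)]. *)
Definition R2 : NormedModule R_AbsRing :=
  prod_NormedModule R_AbsRing R_NormedModule R_NormedModule.

(* Nonnegativity of [N] follows from homogeneity and the triangle inequality. *)
Record is_norm (N : R2 -> R) : Prop := {
  is_norm_triangle : forall x y : R2, N (plus x y) <= N x + N y;
  is_norm_scal : forall (a : R) (x : R2), N (scal a x) = Rabs a * N x;
  is_norm_definite : forall x : R2, N x = 0 -> x = zero
}.

(* On an open set, [ex_diff_n _ 2] at every point says that the partial
   derivatives up to order 2 exist and are continuous there. *)
Definition C2_off_zero (N : R2 -> R) : Prop :=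
  forall u v : R, (u, v) <> (0, 0) -> ex_diff_n (fun a b => N (a, b)) 2 u v.

Definition unit_sphere (N : R2 -> R) (x : R2) : Prop := N x = 1.

(* [Sigma] is defined on the whole line, so it winds around a closed curve;
   [Sigma1] and [Sigma2] are its first and second derivatives, and
   arc length means unit Euclidean speed. *)
Definition arc_length_parametrization
    (S : R2 -> Prop) (Sigma Sigma1 Sigma2 : R -> R2) : Prop :=
  (forall t : R, S (Sigma t)) /\
  (forall x : R2, S x -> exists t : R, Sigma t = x) /\
  (forall t : R, is_derive Sigma t (Sigma1 t)) /\
  (forall t : R, norm (Sigma1 t) = 1) /\
  (forall t : R, is_derive Sigma1 t (Sigma2 t)).

Definition is_curvature (S : R2 -> Prop) (x : R2) (k : R) : Prop :=
  exists (Sigma Sigma1 Sigma2 : R -> R2) (t : R),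
    arc_length_parametrization S Sigma Sigma1 Sigma2 /\
    Sigma t = x /\ k = norm (Sigma2 t).

(* The unit sphere of a norm that is C^2 off 0 has an arc-length
   parametrization, unique up to a shift and a reversal, hence exactly one
   curvature at each point. Its existence is not made part of this condition. *)
Definition positive_curvature (S : R2 -> Prop) : Prop :=
  forall (x : R2) (k : R), S x -> is_curvature S x k -> 0 < k.

Definition opnorm (N : R2 -> R) (T : R2 -> R2) : Rbar :=
  Lub_Rbar (fun r => exists x : R2, N x <= 1 /\ r = N (T x)).

(* [is_linear] includes boundedness for the Euclidean norm, which is automatic
   on [R2]. *)
Definition invertible_linear (T : R2 -> R2) : Prop :=
  is_linear T /\
  exists T' : R2 -> R2, is_linear T' /\
    (forall x : R2, T' (T x) = x) /\ (forall x : R2, T (T' x) = x).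

Definition uniformly_micro_semitransitive (N : R2 -> R) : Prop :=
  forall eps : R, 0 < eps ->
  exists delta : R, 0 < delta /\
  forall x y : R2, unit_sphere N x -> unit_sphere N y -> N (minus x y) < delta ->
  exists T : R2 -> R2,
    invertible_linear T /\
    Rbar_le (opnorm N T) 1 /\
    T x = y /\
    Rbar_lt (opnorm N (fun z => minus (T z) z)) eps.

(* Main.v *)
Require Import Defs.
From Stdlib Require Import Reals Lra ClassicalEpsilon.
From Coquelicot Require Import Coquelicot.
Open Scope R_scope.

(** Fix [lam < 1]. For [x] on the sphere let [tau_x = (- Dy N x, Dx N x)]; it
    spans the tangent at [x] and, by Euler's identity, [det (x, tau_x) = 1]. The
    map sought is [T : x |-> y, tau_x |-> lam tau_y], i.e.
    [T z = (grad N (x) . z) y + lam det (x, z) tau_y]; it is close to the identity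
    when [lam] is close to 1 and [y] to [x]. It is a contraction iff
    [N (a y + lam b tau_y) <= N (a x + b tau_x)] for all [a, b]. For [|b| <= r |a|]
    the two sides agree to first order at [b = 0], and the second derivatives are
    ordered by the factor [lam ^ 2 < 1], because the second derivative of [N]
    along the tangent is positive and uniformly continuous on the sphere. For
    [|b| > r |a|], convexity gives
    [N (a x + b tau_x) - N (a x + lam b tau_x) >= (1 - lam) r^2 |b| / 2],
    which absorbs the change from [x, tau_x] to [y, tau_y].

    That the second derivative along the tangent is positive comes from the
    curvature, once an arc-length parametrization is available; it is the polar
    curve [(cos t, sin t) / N (cos t, sin t)] reparametrized by the inverse of its
    arc length. *)

(** * Real analysis *)

(** The partials of [g] exist near the point and are continuous there, so [g] is differentiable and
    the chain rule applies. *)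
Lemma is_derive_comp_2d (g : R -> R -> R) (p q : R -> R) (t dp dq : R) :
  locally (p t, q t) (fun w : R * R => ex_diff_n g 1 (fst w) (snd w)) ->
  is_derive p t dp -> is_derive q t dq ->
  is_derive (fun s => g (p s) (q s)) t
    (Derive (fun z => g z (q t)) (p t) * dp + Derive (fun z => g (p t) z) (q t) * dq).
Proof.
  intros Hg Hp Hq.
  apply is_derive_Reals, derivable_pt_lim_comp_2d; [|now apply is_derive_Reals..].
  apply filterdiff_differentiable_pt_lim.
  destruct (locally_singleton _ _ Hg) as (_ & _ & Hy & (Cx & _) & _).
  eapply filterdiff_ext_lin.
  - apply (is_derive_filterdiff g (p t) (q t) (fun u v => Derive (fun z => g z v) u)
             (Derive (fun z => g (p t) z) (q t))).
    + revert Hg; apply filter_imp; intros [u v] (_ & Hx & _); apply Derive_correct, Hx.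
    + apply Derive_correct, Hy.
    + now apply continuity_2d_pt_filterlim in Cx.
  - intros [u v]; reflexivity.
Qed.

Lemma is_derive_pair (p q : R -> R) (t dp dq : R) :
  is_derive p t dp -> is_derive q t dq ->
  is_derive (fun s => (p s, q s) : R2) t (dp, dq).
Proof.
  intros Hp Hq.
  apply (filterdiff_comp'_2 p q (fun a b => (a, b) : R2) t _ _ (fun a b => (a, b)) Hp Hq).
  apply (filterdiff_linear (fun t : prod_NormedModule R_AbsRing R_NormedModule R_NormedModule
                             => (fst t, snd t))).
  apply is_linear_prod; [apply is_linear_fst | apply is_linear_snd].
Qed.

Lemma is_derive_le_lipschitz (f : R -> R) (t l K : R) :
  is_derive f t l -> (forall h, Rabs (f (t + h) - f t) <= K * Rabs h) -> Rabs l <= K.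
Proof.
  intros Hf HK; apply is_derive_Reals in Hf.
  apply le_epsilon; intros e He.
  destruct (Hf e He) as [d Hd].
  assert (Hd0 := cond_pos d).
  specialize (Hd (d / 2) ltac:(lra) ltac:(rewrite Rabs_pos_eq; lra)).
  specialize (HK (d / 2)).
  assert (Hq : Rabs ((f (t + d / 2) - f t) / (d / 2)) <= K).
  { unfold Rdiv at 1; rewrite Rabs_mult, Rabs_inv.
    apply Rmult_le_reg_r with (Rabs (d / 2)); [apply Rabs_pos_lt; lra|].
    rewrite Rmult_assoc, Rinv_l; [lra|]. apply Rabs_no_R0; lra. }
  revert Hd Hq; unfold Rabs; repeat destruct Rcase_abs; lra.
Qed.

(** The mean value theorem, used twice, writes [f t] as [ddf e * (c * t)] with [c] between 0 and
    [t], so that [c * t] is nonnegative for either sign of [t]. *)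
Lemma nonneg_of_second_derivative (f df ddf : R -> R) (r : R) :
  (forall t, Rabs t <= r -> is_derive f t (df t)) ->
  (forall t, Rabs t <= r -> is_derive df t (ddf t)) ->
  f 0 = 0 -> df 0 = 0 -> (forall t, Rabs t <= r -> 0 <= ddf t) ->
  forall t, Rabs t <= r -> 0 <= f t.
Proof.
  intros Hf Hdf f0 df0 Hpos t Ht.
  assert (Hin : forall s x, Rmin 0 s <= x <= Rmax 0 s -> Rabs x <= Rabs s /\ 0 <= x * s).
  { intros s x; unfold Rmin, Rmax, Rabs; repeat destruct Rcase_abs; destruct Rle_dec; intros; nra. }
  destruct (MVT_gen f 0 t df) as (c & Hc & Ec).
  - intros x Hx; apply Hf. destruct (Hin t x); lra.
  - intros x Hx; apply continuity_pt_filterlim, (ex_derive_continuous f x).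
    exists (df x); apply Hf. destruct (Hin t x); lra.
  - destruct (Hin t c Hc) as [Hct Hs].
    destruct (MVT_gen df 0 c ddf) as (e & He & Ee).
    + intros x Hx; apply Hdf. destruct (Hin c x); lra.
    + intros x Hx; apply continuity_pt_filterlim, (ex_derive_continuous df x).
      exists (ddf x); apply Hdf. destruct (Hin c x); lra.
    + destruct (Hin c e He) as [Hec _].
      assert (0 <= ddf e) by (apply Hpos; lra).
      replace (f t) with (ddf e * (c * t)) by (rewrite df0 in Ee; rewrite f0 in Ec; nra).
      now apply Rmult_le_pos.
Qed.

(** A slope of at least [c] makes [s] injective and unbounded both ways, hence bijective. The
    derivative of the inverse comes from difference quotients, the increment [k] of [th] being at
    most [Rabs h / c]. *)
Lemma inverse_of_expanding (s w : R -> R) (c : R) :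
  0 < c -> (forall x, is_derive s x (w x)) -> (forall x, c <= w x) ->
  exists th : R -> R, (forall t, s (th t) = t) /\ (forall x, th (s x) = x) /\
    forall t, is_derive th t (/ w (th t)).
Proof.
  intros Hc Hs Hw.
  assert (Cs : continuity s).
  { intros x; apply continuity_pt_filterlim, (ex_derive_continuous s x); now exists (w x). }
  assert (Hexp : forall x y, c * Rabs (y - x) <= Rabs (s y - s x)).
  { intros x y. destruct (MVT_gen s x y w) as (z & _ & ->).
    - intros; apply Hs.
    - intros; apply Cs.
    - rewrite Rabs_mult; apply Rmult_le_compat_r; [apply Rabs_pos|].
      rewrite Rabs_pos_eq; specialize (Hw z); lra. }
  assert (Hgrow : forall x y, x <= y -> c * (y - x) <= s y - s x).
  { intros x y Hxy. destruct (MVT_gen s x y w) as (z & _ & ->).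
    - intros; apply Hs.
    - intros; apply Cs.
    - apply Rmult_le_compat_r; [lra | apply Hw]. }
  assert (Hsurj : forall t, exists x, s x = t).
  (* Over a length [m] the function [s] moves by at least [Rabs (t - s 0)], so [t] lies between
     [s (- m)] and [s m]. *)
  { intros t. set (m := Rabs (t - s 0) / c).
    assert (Hm : c * m = Rabs (t - s 0)) by (unfold m; field; lra).
    assert (Hm0 : 0 <= m) by (apply Rmult_le_pos; [apply Rabs_pos | left; now apply Rinv_0_lt_compat]).
    assert (H1 := Hgrow 0 m Hm0). assert (H2 := Hgrow (- m) 0 ltac:(lra)).
    assert (H3 := Rle_abs (t - s 0)). assert (H4 := Rabs_maj2 (t - s 0)).
    destruct (IVT_gen s (- m) m t Cs) as (x & _ & Hx).
    - unfold Rmin, Rmax; repeat destruct Rle_dec; lra.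
    - now exists x. }
  assert (Hinj : forall x y, s x = s y -> x = y).
  { intros x y E; specialize (Hexp x y); rewrite E, Rminus_diag, Rabs_R0 in Hexp.
    assert (Rabs (y - x) = 0) as H by (generalize (Rabs_pos (y - x)); nra).
    apply Rabs_eq_0 in H; lra. }
  set (th t := proj1_sig (constructive_indefinite_description _ (Hsurj t))).
  assert (Hth : forall t, s (th t) = t).
  { intros t; unfold th; now destruct constructive_indefinite_description. }
  exists th; split; [exact Hth | split; [intros x; apply Hinj, Hth |]].
  intros t; apply is_derive_Reals; intros e He.
  set (a := th t). assert (Hwa := Hw a).
  (* Up to sign, [k / h - / w a] is [h / k - w a] times [k / h] times [/ w a], and
     [Rabs (k / h) <= / c]; hence the tolerance [e * c * w a]. *)
  destruct (proj1 (is_derive_Reals _ _ _) (Hs a) (e * c * w a)) as [d Hd].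
  { repeat apply Rmult_lt_0_compat; lra. }
  assert (Hcd : 0 < c * d) by (apply Rmult_lt_0_compat; [lra | apply cond_pos]).
  exists (mkposreal _ Hcd); simpl; intros h Hh0 Hh.
  set (k := th (t + h) - a).
  assert (Hk : s (a + k) - s a = h).
  { unfold k, a; replace (th t + (th (t + h) - th t)) with (th (t + h)) by ring.
    rewrite !Hth; ring. }
  assert (Hk0 : k <> 0) by (intros E; rewrite E, Rplus_0_r in Hk; lra).
  assert (Hkh : c * Rabs k <= Rabs h).
  { rewrite <- Hk. replace k with (a + k - a) at 1 by ring. apply Hexp. }
  specialize (Hd k Hk0 ltac:(nra)). rewrite Hk in Hd.
  fold a; fold k.
  replace (k / h - / w a) with (- ((h / k - w a) * (k / h) * / w a)) by (field; lra).
  rewrite Rabs_Ropp, !Rabs_mult, (Rabs_inv (w a)), (Rabs_pos_eq (w a)) by lra.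
  assert (Hq : Rabs (k / h) <= / c).
  { unfold Rdiv; rewrite Rabs_mult, Rabs_inv.
    apply Rmult_le_reg_l with (c * Rabs h); [apply Rmult_lt_0_compat; [lra | now apply Rabs_pos_lt]|].
    replace (c * Rabs h * (Rabs k * / Rabs h)) with (c * Rabs k) by (field; now apply Rabs_no_R0).
    replace (c * Rabs h * / c) with (Rabs h) by (field; lra). exact Hkh. }
  apply Rmult_lt_reg_r with (w a); [lra|].
  rewrite Rmult_assoc, Rinv_l, Rmult_1_r by lra.
  apply Rle_lt_trans with (Rabs (h / k - w a) * / c).
  - apply Rmult_le_compat_l; [apply Rabs_pos | exact Hq].
  - apply Rmult_lt_reg_r with c; [lra|].
    rewrite Rmult_assoc, Rinv_l, Rmult_1_r by lra. nra.
Qed.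

(** A Lebesgue number argument on the square of half-side [K]. The local radii are halved so that a
    point near a centre and a second point near the first both stay within the full radius. [P]
    carries the radius, and is inherited by smaller ones, so that bounds depending on it become
    uniform too. *)
Lemma local_to_uniform (S : R -> R -> Prop) (P : R -> R -> R -> R -> R -> Prop) (K : R) :
  (forall u v, S u v -> Rabs u <= K /\ Rabs v <= K) ->
  (forall u v u' v' r s, s <= r -> P u v u' v' r -> P u v u' v' s) ->
  (forall a b, exists r, 0 < r /\ forall u v u' v',
     S u v -> S u' v' -> Rabs (u - a) < r -> Rabs (v - b) < r ->
     Rabs (u' - a) < r -> Rabs (v' - b) < r -> P u v u' v' r) ->
  exists d, 0 < d /\ forall u v u' v', S u v -> S u' v' ->
    Rabs (u - u') < d -> Rabs (v - v') < d -> P u v u' v' d.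
Proof.
  intros HS Hanti Hloc.
  set (rho a b := proj1_sig (constructive_indefinite_description _ (Hloc a b))).
  assert (Hrho : forall a b, 0 < rho a b / 2).
  { intros a b; unfold rho; destruct constructive_indefinite_description; simpl; lra. }
  destruct (compactness_value_2d (- K) K (- K) K (fun a b => mkposreal _ (Hrho a b))) as [d Hd].
  exists d; split; [apply cond_pos|]; intros u v u' v' Hu Hu' H1 H2.
  destruct (HS u v Hu) as [Ku Kv]; apply Rabs_le_between in Ku, Kv.
  (* Compactness provides the centre only under a double negation. *)
  apply NNPP; intros Hn; apply (Hd u v Ku Kv); intros (a & b & _ & _ & H3 & H4 & H5).
  apply Hn; simpl in *.
  apply Hanti with (rho a b); [generalize (Hrho a b); lra|].
  revert H3 H4 H5; unfold rho; destruct constructive_indefinite_description as (r & Hr & HP).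
  simpl; intros H3 H4 H5; apply HP; trivial; try lra.
  - replace (u' - a) with ((u - a) - (u - u')) by ring.
    eapply Rle_lt_trans; [apply Rabs_triang|]; rewrite Rabs_Ropp; lra.
  - replace (v' - b) with ((v - b) - (v - v')) by ring.
    eapply Rle_lt_trans; [apply Rabs_triang|]; rewrite Rabs_Ropp; lra.
Qed.

Lemma continuous_comp_2d {U : UniformSpace} (g : R -> R -> R) (p q : U -> R) (x : U) :
  continuity_2d_pt g (p x) (q x) -> continuous p x -> continuous q x ->
  continuous (fun w => g (p w) (q w)) x.
Proof.
  intros Hg Hp Hq; apply (continuous_comp_2 p q g x Hp Hq).
  now apply continuity_2d_pt_filterlim in Hg.
Qed.

Lemma continuous_Rplus {U : UniformSpace} (p q : U -> R) (x : U) :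
  continuous p x -> continuous q x -> continuous (fun w => p w + q w) x.
Proof. apply @continuous_plus. Qed.

Lemma continuous_Rmult {U : UniformSpace} (p q : U -> R) (x : U) :
  continuous p x -> continuous q x -> continuous (fun w => p w * q w) x.
Proof. apply @continuous_mult. Qed.

(** * Planar norms of class C^2 *)

(** Convertible with the partials inside [ex_diff_n], so the C^2 hypothesis applies to [Dx f] and
    [Dy f] directly. *)
Definition Dx (g : R -> R -> R) (u v : R) : R := Derive (fun z => g z v) u.
Definition Dy (g : R -> R -> R) (u v : R) : R := Derive (fun z => g u z) v.

(** Balls of the product space are squares, and the open one of half-side [Rmax (Rabs p) (Rabs q)]
    misses the origin. *)
Lemma locally_nonzero (p q : R) :
  (p, q) <> (0, 0) -> locally (p, q) (fun w : R * R => w <> (0, 0)).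
Proof.
  intros H.
  assert (H0 : 0 < Rmax (Rabs p) (Rabs q)).
  { apply Rnot_le_lt; intros H0; apply H.
    assert (Hp := Rmax_l (Rabs p) (Rabs q)); assert (Hq := Rmax_r (Rabs p) (Rabs q)).
    f_equal; apply Rabs_eq_0; generalize (Rabs_pos p) (Rabs_pos q); lra. }
  exists (mkposreal _ H0); intros [u v] [Hu Hv] E; injection E as -> ->; simpl in *.
  change (Rabs (0 - p) < Rmax (Rabs p) (Rabs q)) in Hu.
  change (Rabs (0 - q) < Rmax (Rabs p) (Rabs q)) in Hv.
  rewrite Rminus_0_l, Rabs_Ropp in Hu, Hv.
  revert Hu Hv; apply Rmax_case; lra.
Qed.

Section PlanarNorm.

Context (f : R -> R -> R)
  (f_triangle : forall u v u' v', f (u + u') (v + v') <= f u v + f u' v')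
  (f_scal : forall a u v, f (a * u) (a * v) = Rabs a * f u v)
  (f_definite : forall u v, f u v = 0 -> u = 0 /\ v = 0)
  (f_C2 : forall u v, (u, v) <> (0, 0) -> ex_diff_n f 2 u v).

Lemma norm_0 : f 0 0 = 0.
Proof.
  replace (f 0 0) with (f (0 * 0) (0 * 0)) by now rewrite !Rmult_0_l.
  rewrite f_scal, Rabs_R0; ring.
Qed.

Lemma norm_opp u v : f (- u) (- v) = f u v.
Proof.
  replace (f (- u) (- v)) with (f (-1 * u) (-1 * v)) by (f_equal; ring).
  rewrite f_scal, Rabs_left by lra; ring.
Qed.

Lemma norm_nonneg u v : 0 <= f u v.
Proof.
  assert (H := f_triangle u v (- u) (- v)).
  rewrite !Rplus_opp_r, norm_opp, norm_0 in H; lra.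
Qed.

Lemma norm_pos u v : (u, v) <> (0, 0) -> 0 < f u v.
Proof.
  intros H; destruct (norm_nonneg u v) as [Hp | E]; trivial.
  destruct (f_definite u v) as [-> ->]; [easy | now destruct H].
Qed.

Lemma norm_nonzero u v : 0 < f u v -> (u, v) <> (0, 0).
Proof. intros H E; injection E as -> ->; rewrite norm_0 in H; lra. Qed.

Lemma norm_sub_le u v u' v' : Rabs (f u v - f u' v') <= f (u - u') (v - v').
Proof.
  assert (H1 := f_triangle (u - u') (v - v') u' v').
  assert (H2 := f_triangle (u' - u) (v' - v) u v).
  assert (H3 := norm_opp (u - u') (v - v')).
  replace (u - u' + u') with u in H1 by ring; replace (v - v' + v') with v in H1 by ring.
  replace (u' - u + u) with u' in H2 by ring; replace (v' - v + v) with v' in H2 by ring.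
  replace (- (u - u')) with (u' - u) in H3 by ring; replace (- (v - v')) with (v' - v) in H3 by ring.
  apply Rabs_le; lra.
Qed.

Lemma norm_le_coords u v : f u v <= Rabs u * f 1 0 + Rabs v * f 0 1.
Proof.
  rewrite <- !f_scal.
  replace (f u v) with (f (u * 1 + v * 0) (u * 0 + v * 1)) by (f_equal; ring).
  apply f_triangle.
Qed.

Lemma is_derive_norm (p q : R -> R) (t dp dq : R) :
  (p t, q t) <> (0, 0) -> is_derive p t dp -> is_derive q t dq ->
  is_derive (fun s => f (p s) (q s)) t (Dx f (p t) (q t) * dp + Dy f (p t) (q t) * dq).
Proof.
  intros H Hp Hq; apply is_derive_comp_2d; trivial.
  generalize (locally_nonzero _ _ H); apply filter_imp; intros [u v] Hw.
  destruct (f_C2 u v Hw) as (C & Ex & Ey & (Cx & _) & (Cy & _)); now repeat split.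
Qed.

Lemma is_derive_Dx_norm (p q : R -> R) (t dp dq : R) :
  (p t, q t) <> (0, 0) -> is_derive p t dp -> is_derive q t dq ->
  is_derive (fun s => Dx f (p s) (q s)) t
    (Dx (Dx f) (p t) (q t) * dp + Dy (Dx f) (p t) (q t) * dq).
Proof.
  intros H Hp Hq; apply (is_derive_comp_2d (Dx f)); trivial.
  generalize (locally_nonzero _ _ H); apply filter_imp; intros [u v] Hw.
  now destruct (f_C2 u v Hw) as (_ & _ & _ & C & _).
Qed.

Lemma is_derive_Dy_norm (p q : R -> R) (t dp dq : R) :
  (p t, q t) <> (0, 0) -> is_derive p t dp -> is_derive q t dq ->
  is_derive (fun s => Dy f (p s) (q s)) t
    (Dx (Dy f) (p t) (q t) * dp + Dy (Dy f) (p t) (q t) * dq).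
Proof.
  intros H Hp Hq; apply (is_derive_comp_2d (Dy f)); trivial.
  generalize (locally_nonzero _ _ H); apply filter_imp; intros [u v] Hw.
  now destruct (f_C2 u v Hw) as (_ & _ & _ & _ & C).
Qed.

(** The Hessian quadratic form of [f] at [(u, v)] in the direction [(a, b)], in the shape that
    differentiating twice along a curve produces. *)
Definition hess (u v a b : R) : R :=
  (Dx (Dx f) u v * a + Dy (Dx f) u v * b) * a + (Dx (Dy f) u v * a + Dy (Dy f) u v * b) * b.

Lemma is_derive_line (a b t : R) : is_derive (fun s => a + s * b) t b.
Proof. auto_derive; trivial; ring. Qed.

Lemma is_derive_norm_line (u v a b t : R) : (u + t * a, v + t * b) <> (0, 0) ->
  is_derive (fun s => f (u + s * a) (v + s * b)) t
    (Dx f (u + t * a) (v + t * b) * a + Dy f (u + t * a) (v + t * b) * b).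
Proof.
  intros H; apply (is_derive_norm (fun s => u + s * a) (fun s => v + s * b)); trivial;
    apply is_derive_line.
Qed.

Lemma is_derive2_norm_line (u v a b t : R) : (u + t * a, v + t * b) <> (0, 0) ->
  is_derive (fun s => Dx f (u + s * a) (v + s * b) * a + Dy f (u + s * a) (v + s * b) * b) t
    (hess (u + t * a) (v + t * b) a b).
Proof.
  intros H.
  assert (Hx := is_derive_Dx_norm (fun s => u + s * a) (fun s => v + s * b) t a b H
                  (is_derive_line _ _ _) (is_derive_line _ _ _)).
  assert (Hy := is_derive_Dy_norm (fun s => u + s * a) (fun s => v + s * b) t a b H
                  (is_derive_line _ _ _) (is_derive_line _ _ _)).
  apply @is_derive_plus with (f := fun s => Dx f (u + s * a) (v + s * b) * a)
    (g := fun s => Dy f (u + s * a) (v + s * b) * b).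
  - apply (is_derive_ext (fun s => scal a (Dx f (u + s * a) (v + s * b))));
      [intros; apply Rmult_comm|].
    rewrite (Rmult_comm _ a); now apply @is_derive_scal.
  - apply (is_derive_ext (fun s => scal b (Dy f (u + s * a) (v + s * b))));
      [intros; apply Rmult_comm|].
    rewrite (Rmult_comm _ b); now apply @is_derive_scal.
Qed.

(** A norm is 1-Lipschitz for itself, which bounds its directional derivatives: the gradient has
    dual norm at most 1. *)
Lemma gradient_le (u v a b : R) : (u, v) <> (0, 0) -> Rabs (Dx f u v * a + Dy f u v * b) <= f a b.
Proof.
  intros H.
  assert (Hd := is_derive_norm_line u v a b 0); rewrite !Rmult_0_l, !Rplus_0_r in Hd.
  apply (is_derive_le_lipschitz _ _ _ _ (Hd H)); intros h.
  eapply Rle_trans; [apply norm_sub_le|].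
  rewrite (Rmult_comm (f a b)), <- f_scal; right; f_equal; ring.
Qed.

(** Both sides are the derivative at [s = 0] of [f] at [(1 + s)] times the point; for [Rabs s < 1]
    the factor [1 + s] is positive and comes out of the norm. *)
Lemma euler (u v : R) : (u, v) <> (0, 0) -> Dx f u v * u + Dy f u v * v = f u v.
Proof.
  intros H.
  assert (Hd := is_derive_norm_line u v u v 0); rewrite !Rmult_0_l, !Rplus_0_r in Hd.
  rewrite <- (is_derive_unique _ _ _ (Hd H)).
  apply is_derive_unique.
  apply (is_derive_ext_loc (fun s => (1 + s) * f u v)).
  - exists (mkposreal 1 Rlt_0_1); intros s Hs.
    change (Rabs (s - 0) < 1) in Hs; rewrite Rminus_0_r in Hs; apply Rabs_lt_between in Hs.
    rewrite <- (Rabs_pos_eq (1 + s)), <- f_scal by lra; f_equal; ring.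
  - auto_derive; trivial; ring.
Qed.

Lemma Dx_norm_le (u v : R) : (u, v) <> (0, 0) -> Rabs (Dx f u v) <= f 1 0.
Proof. intros H; generalize (gradient_le u v 1 0 H); now rewrite Rmult_1_r, Rmult_0_r, Rplus_0_r. Qed.

Lemma Dy_norm_le (u v : R) : (u, v) <> (0, 0) -> Rabs (Dy f u v) <= f 0 1.
Proof. intros H; generalize (gradient_le u v 0 1 H); now rewrite Rmult_1_r, Rmult_0_r, Rplus_0_l. Qed.

Lemma circle_nonzero t : (cos t, sin t) <> (0, 0).
Proof. intros E; injection E as Ec Es; generalize (sin2_cos2 t); unfold Rsqr; rewrite Ec, Es; lra. Qed.

(** The angle is [acos (u / r)] with the sign of [v]. Its compact range allows minimizing over the
    circle. *)
Lemma polar (u v : R) : (u, v) <> (0, 0) ->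
  exists r t, 0 < r /\ - PI <= t <= PI /\ u = r * cos t /\ v = r * sin t.
Proof.
  intros H. set (r := sqrt (u ^ 2 + v ^ 2)).
  assert (H2 : 0 < u ^ 2 + v ^ 2).
  { apply Rnot_le_lt; intros H2; apply H; f_equal; nra. }
  assert (Hr : 0 < r) by now apply sqrt_lt_R0.
  assert (Er : r * r = u ^ 2 + v ^ 2) by (apply sqrt_def; lra).
  assert (Hb : -1 <= u / r <= 1).
  { assert (E : r * (u / r) = u) by (field; lra).
    split; apply Rmult_le_reg_l with r; trivial; nra. }
  assert (Hs : r * sqrt (1 - Rsqr (u / r)) = Rabs v).
  { rewrite <- (Rabs_pos_eq r) at 1 by lra. rewrite <- sqrt_Rsqr_abs, <- sqrt_mult.
    - rewrite <- sqrt_Rsqr_abs; f_equal; unfold Rsqr.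
      replace (v * v) with (r * r - u * u) by lra. field; lra.
    - apply Rle_0_sqr.
    - unfold Rsqr; nra. }
  assert (Ha := acos_bound (u / r)).
  assert (Hc : u = r * cos (acos (u / r))) by (rewrite cos_acos by trivial; field; lra).
  destruct (Rle_dec 0 v) as [Hv | Hv].
  - exists r, (acos (u / r)); repeat split; trivial; try lra.
    rewrite sin_acos, Hs, Rabs_pos_eq; lra.
  - exists r, (- acos (u / r)); rewrite cos_neg, sin_neg; repeat split; trivial; try lra.
    rewrite sin_acos by trivial. rewrite <- Ropp_mult_distr_r, Hs, Rabs_left; lra.
Qed.

Lemma is_derive_norm_circle t :
  is_derive (fun t => f (cos t) (sin t)) t
    (Dx f (cos t) (sin t) * - sin t + Dy f (cos t) (sin t) * cos t).
Proof.
  apply is_derive_norm; [apply circle_nonzero | apply is_derive_cos | apply is_derive_sin].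
Qed.

(** [K] is the inverse of the minimum of [f] on the Euclidean unit circle, positive by
    compactness. *)
Lemma norm_coercive : exists K, 0 < K /\ forall u v, Rabs u <= K * f u v /\ Rabs v <= K * f u v.
Proof.
  destruct (continuity_ab_min (fun t => f (cos t) (sin t)) (- PI) PI) as (t0 & Hmin & _).
  - generalize PI_RGT_0; lra.
  - intros t _; apply continuity_pt_filterlim,
      (ex_derive_continuous (fun t => f (cos t) (sin t)) t).
    eexists; apply is_derive_norm_circle.
  - set (m := f (cos t0) (sin t0)) in *.
    assert (Hm : 0 < m) by apply norm_pos, circle_nonzero.
    exists (/ m); split; [now apply Rinv_0_lt_compat|]; intros u v.
    assert (Hall : forall r t c, 0 < r -> m <= f (cos t) (sin t) -> -1 <= c <= 1 ->
      Rabs (r * c) <= / m * f (r * cos t) (r * sin t)).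
    { intros r t c Hr Ht Hc; rewrite f_scal, Rabs_mult, (Rabs_pos_eq r) by lra.
      apply Rabs_le in Hc.
      apply Rmult_le_reg_l with m; trivial.
      replace (m * (/ m * (r * f (cos t) (sin t)))) with (r * f (cos t) (sin t)) by (field; lra).
      replace (m * (r * Rabs c)) with (r * (m * Rabs c)) by ring.
      apply Rmult_le_compat_l; [lra | generalize (Rabs_pos c); nra]. }
    destruct (classic ((u, v) = (0, 0))) as [E | E].
    + injection E as -> ->; rewrite norm_0, Rabs_R0; lra.
    + destruct (polar u v E) as (r & t & Hr & Ht & -> & ->).
      specialize (Hmin t Ht); simpl in Hmin.
      split; apply Hall; trivial; [apply COS_bound | apply SIN_bound].
Qed.

(** * Arc length and curvature *)

(** [positive_curvature] constrains the curvatures that exist; this provides a parametrization to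
    which it can be applied. *)
Lemma arc_length_exists : exists p q p1 q1 p2 q2 : R -> R,
  (forall t, is_derive p t (p1 t)) /\ (forall t, is_derive q t (q1 t)) /\
  (forall t, is_derive p1 t (p2 t)) /\ (forall t, is_derive q1 t (q2 t)) /\
  (forall t, f (p t) (q t) = 1) /\ (forall t, p1 t ^ 2 + q1 t ^ 2 = 1) /\
  (forall u v, f u v = 1 -> exists t, p t = u /\ q t = v).
Proof.
  set (n t := f (cos t) (sin t)).
  set (n1 t := Dx f (cos t) (sin t) * - sin t + Dy f (cos t) (sin t) * cos t).
  assert (Hn : forall t, is_derive n t (n1 t)) by apply is_derive_norm_circle.
  assert (Hn1 : forall t, ex_derive n1 t).
  { intros t; unfold n1.
    apply @ex_derive_plus with (f := fun t => Dx f (cos t) (sin t) * - sin t)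
      (g := fun t => Dy f (cos t) (sin t) * cos t); apply ex_derive_mult.
    - eexists; apply is_derive_Dx_norm;
        [apply circle_nonzero | apply is_derive_cos | apply is_derive_sin].
    - auto_derive; trivial.
    - eexists; apply is_derive_Dy_norm;
        [apply circle_nonzero | apply is_derive_cos | apply is_derive_sin].
    - auto_derive; trivial. }
  assert (Hn0 : forall t, 0 < n t) by (intros t; apply norm_pos, circle_nonzero).
  assert (Hsq : forall t, 0 < n t ^ 2 + n1 t ^ 2).
  { intros t; specialize (Hn0 t); assert (0 < n t ^ 2) by now apply pow_lt.
    generalize (pow2_ge_0 (n1 t)); lra. }
  set (h t := sqrt (n t ^ 2 + n1 t ^ 2)).
  assert (Hh0 : forall t, 0 < h t) by (intros t; now apply sqrt_lt_R0).
  assert (Hh2 : forall t, h t * h t = n t ^ 2 + n1 t ^ 2)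
    by (intros t; apply sqrt_def; left; apply Hsq).
  assert (Hh : forall t, ex_derive h t).
  { intros t; unfold h; auto_derive; repeat apply conj;
      [eexists; apply Hn | apply Hn1 | exact (Hsq t) | trivial]. }
  (* [w] is the Euclidean speed of the polar curve [(cos t, sin t) / n t], and [s] below is its arc
     length. *)
  set (w t := h t / n t ^ 2).
  assert (Cw : forall t, continuous w t).
  { intros t; apply (ex_derive_continuous w); unfold w; auto_derive; repeat split; trivial.
    - eexists; apply Hn.
    - specialize (Hn0 t); nra. }
  set (s t := RInt w 0 t).
  assert (Hs : forall t, is_derive s t (w t)).
  { intros t; apply (is_derive_RInt w s 0 t (filter_forall _ (fun b => RInt_correct w 0 b
      (ex_RInt_continuous w 0 b (fun z _ => Cw z)))) (Cw t)). }
  set (M := f 1 0 + f 0 1).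
  assert (HnM : forall t, n t <= M).
  { intros t; unfold n, M; eapply Rle_trans; [apply norm_le_coords|].
    assert (Hc := COS_bound t); assert (Hs1 := SIN_bound t).
    apply Rabs_le in Hc, Hs1.
    generalize (norm_nonneg 1 0) (norm_nonneg 0 1); nra. }
  assert (HM : 0 < M) by (specialize (Hn0 0); specialize (HnM 0); lra).
  (* Since [h >= n], the speed is at least [/ n], hence at least [/ M]; this makes the arc length
     expanding. *)
  assert (Hw : forall t, / M <= w t).
  { intros t; specialize (Hn0 t); specialize (HnM t); specialize (Hh0 t); specialize (Hh2 t).
    assert (n t <= h t) by (generalize (pow2_ge_0 (n1 t)); nra).
    apply Rle_trans with (/ n t); [now apply Rinv_le_contravar|].
    replace (w t) with (h t / n t * / n t) by (unfold w; field; lra).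
    rewrite <- (Rmult_1_l (/ n t)) at 1.
    apply Rmult_le_compat_r; [left; now apply Rinv_0_lt_compat|].
    apply Rmult_le_reg_r with (n t); trivial; field_simplify; lra. }
  destruct (inverse_of_expanding s w (/ M) (Rinv_0_lt_compat _ HM) Hs Hw) as (th & Hsth & Hths & Hth).
  assert (Hw0 : forall t, 0 < w t).
  { intros t; eapply Rlt_le_trans; [apply Rinv_0_lt_compat, HM | apply Hw]. }
  set (p a := cos a / n a). set (q a := sin a / n a).
  (* The unit tangent as a function of the polar angle: velocity divided by the speed [w]. *)
  set (p1 a := (- sin a * n a - cos a * n1 a) / h a).
  set (q1 a := (cos a * n a - sin a * n1 a) / h a).
  assert (Hp : forall a, is_derive p a (p1 a * w a)).
  { intros a; unfold p; specialize (Hn0 a); specialize (Hh0 a); auto_derive.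
    - repeat split; [eexists; apply Hn | lra].
    - change (Derive (fun x : R => n x) a) with (Derive n a).
      rewrite (is_derive_unique _ _ _ (Hn a)); unfold p1, w; field; split; lra. }
  assert (Hq : forall a, is_derive q a (q1 a * w a)).
  { intros a; unfold q; specialize (Hn0 a); specialize (Hh0 a); auto_derive.
    - repeat split; [eexists; apply Hn | lra].
    - change (Derive (fun x : R => n x) a) with (Derive n a).
      rewrite (is_derive_unique _ _ _ (Hn a)); unfold q1, w; field; split; lra. }
  assert (Hp1 : forall a, ex_derive p1 a).
  { intros a; unfold p1; specialize (Hh0 a); auto_derive; repeat split; trivial; try lra; eexists; apply Hn. }
  assert (Hq1 : forall a, ex_derive q1 a).
  { intros a; unfold q1; specialize (Hh0 a); auto_derive; repeat split; trivial; try lra; eexists; apply Hn. }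
  assert (Hcomp : forall g g1, (forall a, is_derive g a (g1 a * w a)) ->
    forall t, is_derive (fun t => g (th t)) t (g1 (th t))).
  { intros g g1 Hg t.
    replace (g1 (th t)) with (scal (/ w (th t)) (g1 (th t) * w (th t))).
    - apply (is_derive_comp g th t); [apply Hg | apply Hth].
    - change (/ w (th t) * (g1 (th t) * w (th t)) = g1 (th t)). specialize (Hw0 (th t)). field; lra. }
  exists (fun t => p (th t)), (fun t => q (th t)), (fun t => p1 (th t)), (fun t => q1 (th t)).
  exists (Derive (fun t => p1 (th t))), (Derive (fun t => q1 (th t))).
  split; [now apply Hcomp|]. split; [now apply Hcomp|].
  split; [intros t; apply Derive_correct, ex_derive_comp; [apply Hp1 | eexists; apply Hth]|].
  split; [intros t; apply Derive_correct, ex_derive_comp; [apply Hq1 | eexists; apply Hth]|].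
  split; [|split].
  - intros t; unfold p, q; set (a := th t); specialize (Hn0 a).
    replace (f _ _) with (f (/ n a * cos a) (/ n a * sin a)) by (f_equal; field; lra).
    rewrite f_scal, Rabs_pos_eq by (left; now apply Rinv_0_lt_compat).
    change (/ n a * n a = 1); field; lra.
  - intros t; unfold p1, q1; set (a := th t); specialize (Hh0 a); specialize (Hh2 a).
    assert (Hcs := sin2_cos2 a); unfold Rsqr in Hcs.
    replace (_ + _) with ((sin a * sin a + cos a * cos a) * (n a ^ 2 + n1 a ^ 2) / (h a * h a))
      by (field; lra).
    rewrite Hcs, <- Hh2; field; lra.
  - intros u v Huv.
    assert (H : (u, v) <> (0, 0)) by (apply norm_nonzero; lra).
    destruct (polar u v H) as (r & a & Hr & _ & -> & ->).
    rewrite f_scal, Rabs_pos_eq in Huv by lra.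
    (* A point of the sphere at angle [a] is reached at arc length [s a], its radius being forced to
       equal [/ n a]. *)
    exists (s a); rewrite Hths; unfold p, q; specialize (Hn0 a); fold (n a) in Huv.
    replace r with (/ n a) by (apply Rmult_eq_reg_r with (n a); [field_simplify|]; lra).
    split; field; lra.
Qed.

Lemma gradient_nonzero u v : 0 < f u v -> 0 < Dx f u v ^ 2 + Dy f u v ^ 2.
Proof.
  intros H; apply Rnot_le_lt; intros H'.
  assert (E := euler u v (norm_nonzero u v H)).
  assert (Dx f u v = 0) as Ex by nra. assert (Dy f u v = 0) as Ey by nra.
  rewrite Ex, Ey in E; lra.
Qed.

Lemma hess_scal u v c a b : hess u v (c * a) (c * b) = c ^ 2 * hess u v a b.
Proof. unfold hess; ring. Qed.

(** By Euler's identity the gradient at [(u, v)], as a linear form, is 1 on the whole tangent line,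
    while it is 0 at the origin. *)
Lemma tangent_nonzero u v t : f u v = 1 ->
  (u + t * - Dy f u v, v + t * Dx f u v) <> (0, 0).
Proof.
  intros H E; injection E as E1 E2.
  assert (E := euler u v (norm_nonzero u v ltac:(lra))).
  assert (Dx f u v * (u + t * - Dy f u v) + Dy f u v * (v + t * Dx f u v) = 0)
    by (rewrite E1, E2; ring).
  lra.
Qed.

(* The second derivative of [f] along the tangent is, up to the length of the
   gradient, the curvature. *)
Lemma hess_tangent_nonzero (p q p1 q1 p2 q2 : R -> R) (t : R) :
  (forall t, is_derive p t (p1 t)) -> (forall t, is_derive q t (q1 t)) ->
  (forall t, is_derive p1 t (p2 t)) -> (forall t, is_derive q1 t (q2 t)) ->
  (forall t, f (p t) (q t) = 1) -> (forall t, p1 t ^ 2 + q1 t ^ 2 = 1) ->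
  (p2 t, q2 t) <> (0, 0) ->
  hess (p t) (q t) (- Dy f (p t) (q t)) (Dx f (p t) (q t)) <> 0.
Proof.
  intros Hp Hq Hp1 Hq1 Hf Hl Hne.
  assert (Hnz : forall s, (p s, q s) <> (0, 0)) by (intros s; apply norm_nonzero; rewrite Hf; lra).
  (* Differentiating [f = 1] along the curve: the velocity is orthogonal to the gradient. *)
  assert (E1 : forall s, Dx f (p s) (q s) * p1 s + Dy f (p s) (q s) * q1 s = 0).
  { intros s. rewrite <- (is_derive_unique _ _ _ (is_derive_norm p q s _ _ (Hnz s) (Hp s) (Hq s))).
    rewrite (Derive_ext _ (fun _ => 1)) by exact Hf. apply Derive_const. }
  (* Unit speed: the acceleration is orthogonal to the velocity. *)
  assert (E2 : p1 t * p2 t + q1 t * q2 t = 0).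
  { assert (D : is_derive (fun s => p1 s ^ 2 + q1 s ^ 2) t (2 * (p1 t * p2 t + q1 t * q2 t))).
    { auto_derive; [repeat split; eexists; [apply Hp1 | apply Hq1]|].
      change (Derive (fun x : R => p1 x) t) with (Derive p1 t).
      change (Derive (fun x : R => q1 x) t) with (Derive q1 t).
      rewrite (is_derive_unique _ _ _ (Hp1 t)), (is_derive_unique _ _ _ (Hq1 t)); ring. }
    apply is_derive_unique in D; rewrite (Derive_ext _ (fun _ => 1)), Derive_const in D by exact Hl; lra. }
  (* The second derivative of [f = 1] along the curve. *)
  assert (E3 : hess (p t) (q t) (p1 t) (q1 t) + (Dx f (p t) (q t) * p2 t + Dy f (p t) (q t) * q2 t) = 0).
  { assert (Hx := is_derive_Dx_norm p q t _ _ (Hnz t) (Hp t) (Hq t)).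
    assert (Hy := is_derive_Dy_norm p q t _ _ (Hnz t) (Hp t) (Hq t)).
    assert (D : is_derive (fun s => Dx f (p s) (q s) * p1 s + Dy f (p s) (q s) * q1 s) t
      (hess (p t) (q t) (p1 t) (q1 t) + (Dx f (p t) (q t) * p2 t + Dy f (p t) (q t) * q2 t))).
    { evar_last.
      - apply @is_derive_plus with (f := fun s => Dx f (p s) (q s) * p1 s)
          (g := fun s => Dy f (p s) (q s) * q1 s);
          apply @is_derive_mult; [exact Hx | apply Hp1 | apply Rmult_comm | exact Hy | apply Hq1 | apply Rmult_comm].
      - unfold hess, plus, mult; simpl; ring. }
    apply is_derive_unique in D; rewrite (Derive_ext _ (fun _ => 0)), Derive_const in D by exact E1.
    lra. }
  assert (Hg := gradient_nonzero (p t) (q t) ltac:(rewrite Hf; lra)).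
  specialize (E1 t); specialize (Hl t).
  set (A := Dx f (p t) (q t)) in *; set (B := Dy f (p t) (q t)) in *.
  (* [(-B, A) = mu (p1, q1)] with [mu <> 0] *)
  set (mu := A * q1 t - B * p1 t).
  assert (HB : - B = mu * p1 t).
  { replace (- B) with (- B * (p1 t ^ 2 + q1 t ^ 2)) by (rewrite Hl; ring).
    replace (- B * (p1 t ^ 2 + q1 t ^ 2)) with
      (mu * p1 t - q1 t * (A * p1 t + B * q1 t)) by (unfold mu; ring).
    rewrite E1; ring. }
  assert (HA : A = mu * q1 t).
  { replace A with (A * (p1 t ^ 2 + q1 t ^ 2)) at 1 by (rewrite Hl; ring).
    replace (A * (p1 t ^ 2 + q1 t ^ 2)) with
      (mu * q1 t + p1 t * (A * p1 t + B * q1 t)) by (unfold mu; ring).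
    rewrite E1; ring. }
  assert (Hmu : mu <> 0).
  { intros E; rewrite E, Rmult_0_l in HA, HB; nra. }
  (* If the Hessian vanished on the tangent, [E3] would make the acceleration orthogonal to the
     gradient; being orthogonal to the velocity by [E2], it would be zero. *)
  intros H; apply Hne.
  rewrite HB, HA, hess_scal in H.
  apply Rmult_integral in H; destruct H as [H | H]; [apply pow_nonzero in H; tauto|].
  rewrite H, HA in E3; replace B with (- (mu * p1 t)) in E3 by lra.
  assert (E4 : q1 t * p2 t - p1 t * q2 t = 0).
  { apply Rmult_eq_reg_l with mu; trivial; lra. }
  f_equal.
  - replace (p2 t) with (p2 t * (p1 t ^ 2 + q1 t ^ 2)) by (rewrite Hl; ring).
    replace (p2 t * (p1 t ^ 2 + q1 t ^ 2)) with
      (p1 t * (p1 t * p2 t + q1 t * q2 t) + q1 t * (q1 t * p2 t - p1 t * q2 t)) by ring.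
    rewrite E2, E4; ring.
  - replace (q2 t) with (q2 t * (p1 t ^ 2 + q1 t ^ 2)) by (rewrite Hl; ring).
    replace (q2 t * (p1 t ^ 2 + q1 t ^ 2)) with
      (q1 t * (p1 t * p2 t + q1 t * q2 t) - p1 t * (q1 t * p2 t - p1 t * q2 t)) by ring.
    rewrite E2, E4; ring.
Qed.

(** * Uniform estimates along the tangents *)

(** The second derivative at [b] of [f] along the tangent line at [(u, v)], the direction staying
    frozen at its value at [(u, v)]. *)
Definition tan_hess (u v b : R) : R :=
  hess (u + b * - Dy f u v) (v + b * Dx f u v) (- Dy f u v) (Dx f u v).

Lemma tan_hess_0 u v : tan_hess u v 0 = hess u v (- Dy f u v) (Dx f u v).
Proof. unfold tan_hess; now rewrite !Rmult_0_l, !Rplus_0_r. Qed.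

(** Joint continuity in base point and [b], the direction moving with the base point;
    [tangent_nonzero] keeps the limit point where [f] is C^2. *)
Lemma tan_hess_near (u v eps : R) : f u v = 1 -> 0 < eps ->
  exists r, 0 < r /\ forall u' v' b, Rabs (u' - u) < r -> Rabs (v' - v) < r -> Rabs b < r ->
    Rabs (tan_hess u' v' b - tan_hess u v 0) < eps.
Proof.
  intros Hf Heps.
  assert (H0 : (u, v) <> (0, 0)) by (apply norm_nonzero; lra).
  set (x := ((u, v), 0) : R * R * R).
  assert (Cu : continuous (fun w : R * R * R => fst (fst w)) x)
    by (apply continuous_comp; apply continuous_fst).
  assert (Cv : continuous (fun w : R * R * R => snd (fst w)) x)
    by (apply continuous_comp; [apply continuous_fst | apply continuous_snd]).
  assert (Cb : continuous (fun w : R * R * R => snd w) x) by apply continuous_snd.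
  assert (Cx : continuous (fun w : R * R * R => Dx f (fst (fst w)) (snd (fst w))) x).
  { apply continuous_comp_2d; trivial. destruct (f_C2 u v H0) as (_ & _ & _ & C & _). apply C. }
  assert (Cy : continuous (fun w : R * R * R => - Dy f (fst (fst w)) (snd (fst w))) x).
  { apply @continuous_opp with (f := fun w : R * R * R => Dy f (fst (fst w)) (snd (fst w))).
    apply continuous_comp_2d; trivial. destruct (f_C2 u v H0) as (_ & _ & _ & _ & C). apply C. }
  assert (Cp : continuous (fun w : R * R * R =>
    fst (fst w) + snd w * - Dy f (fst (fst w)) (snd (fst w))) x).
  { apply continuous_Rplus; trivial; now apply continuous_Rmult. }
  assert (Cq : continuous (fun w : R * R * R =>
    snd (fst w) + snd w * Dx f (fst (fst w)) (snd (fst w))) x).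
  { apply continuous_Rplus; trivial; now apply continuous_Rmult. }
  assert (C : continuous (fun w : R * R * R => tan_hess (fst (fst w)) (snd (fst w)) (snd w)) x).
  { destruct (f_C2 _ _ (tangent_nonzero u v 0 Hf)) as (_ & _ & _ & (_ & _ & _ & (Cxx & _) & (Cxy & _))
      & (_ & _ & _ & (Cyx & _) & (Cyy & _))).
    pose proof (continuous_comp_2d _ _ _ x Cxx Cp Cq).
    pose proof (continuous_comp_2d _ _ _ x Cxy Cp Cq).
    pose proof (continuous_comp_2d _ _ _ x Cyx Cp Cq).
    pose proof (continuous_comp_2d _ _ _ x Cyy Cp Cq).
    unfold tan_hess, hess.
    repeat first [ assumption | apply continuous_Rplus | apply continuous_Rmult ]. }
  destruct (proj1 (filterlim_locally _ _) C (mkposreal _ Heps)) as [r Hr].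
  exists r; split; [apply cond_pos|]; intros u' v' b Hu Hv Hb.
  apply (Hr ((u', v'), b)); repeat split; trivial.
  change (Rabs (b - 0) < r); now rewrite Rminus_0_r.
Qed.

Lemma is_derive_tangent (u v t : R) : f u v = 1 ->
  is_derive (fun s => f (u + s * - Dy f u v) (v + s * Dx f u v)) t
    (Dx f (u + t * - Dy f u v) (v + t * Dx f u v) * - Dy f u v
     + Dy f (u + t * - Dy f u v) (v + t * Dx f u v) * Dx f u v).
Proof. intros H; apply is_derive_norm_line, tangent_nonzero, H. Qed.

Lemma is_derive2_tangent (u v t : R) : f u v = 1 ->
  is_derive (fun t => Dx f (u + t * - Dy f u v) (v + t * Dx f u v) * - Dy f u v
     + Dy f (u + t * - Dy f u v) (v + t * Dx f u v) * Dx f u v) t (tan_hess u v t).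
Proof. intros H; apply is_derive2_norm_line, tangent_nonzero, H. Qed.

(** The gradient at [(u, v)] is a form of dual norm at most 1 that reads off the coordinate [a]. *)
Lemma tangent_coord_le (u v a b : R) : f u v = 1 ->
  Rabs a <= f (a * u + b * - Dy f u v) (a * v + b * Dx f u v).
Proof.
  intros H. assert (H0 := norm_nonzero u v ltac:(lra)).
  eapply Rle_trans; [|apply (gradient_le u v); exact H0].
  right; f_equal. transitivity (a * (Dx f u v * u + Dy f u v * v)); [rewrite euler, H by trivial; ring | ring].
Qed.

(** On the tangent line [f] is at least 1, with equality at the point of contact. A second
    derivative [- e < 0] there would stay below [- e / 2] nearby and push [f] under the parabola
    [1 - e / 4 * t ^ 2]. *)
Lemma hess_tangent_nonneg (u v : R) : f u v = 1 -> 0 <= tan_hess u v 0.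
Proof.
  intros Hf; apply Rnot_lt_le; intros Hneg. set (e := - tan_hess u v 0).
  assert (He : 0 < e) by (unfold e; lra).
  destruct (tan_hess_near u v (e / 2) Hf ltac:(lra)) as (r & Hr & Hnear).
  set (g s := f (u + s * - Dy f u v) (v + s * Dx f u v)).
  set (g1 t := Dx f (u + t * - Dy f u v) (v + t * Dx f u v) * - Dy f u v
     + Dy f (u + t * - Dy f u v) (v + t * Dx f u v) * Dx f u v).
  assert (Hg : forall t, is_derive g t (g1 t)) by (intros; now apply is_derive_tangent).
  assert (Hg1 : forall t, is_derive g1 t (tan_hess u v t)) by (intros; now apply is_derive2_tangent).
  assert (H := nonneg_of_second_derivative (fun t => 1 - g t - e / 4 * t ^ 2)
    (fun t => - g1 t - e / 2 * t) (fun t => - tan_hess u v t - e / 2) (r / 2)).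
  assert (Hr2 : Rabs (r / 2) <= r / 2) by (rewrite Rabs_pos_eq; lra).
  assert (Hcon : 0 <= 1 - g (r / 2) - e / 4 * (r / 2) ^ 2).
  { apply H; trivial.
    - intros t _; auto_derive; [repeat split; eexists; apply Hg|].
      change (Derive (fun x : R => g x) t) with (Derive g t).
      rewrite (is_derive_unique _ _ _ (Hg t)); field.
    - intros t _; auto_derive; [repeat split; eexists; apply Hg1|].
      change (Derive (fun x : R => g1 x) t) with (Derive g1 t).
      rewrite (is_derive_unique _ _ _ (Hg1 t)); field.
    - unfold g; rewrite !Rmult_0_l, !Rplus_0_r, Hf; ring.
    - unfold g1; rewrite !Rmult_0_l, !Rplus_0_r; ring.
    - intros t Ht. specialize (Hnear u v t); rewrite !Rminus_diag, Rabs_R0 in Hnear.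
      specialize (Hnear Hr Hr ltac:(lra)); apply Rabs_lt_between in Hnear; unfold e in *; lra. }
  assert (Hge := tangent_coord_le u v 1 (r / 2) Hf).
  rewrite !Rmult_1_l, Rabs_R1 in Hge; fold (g (r / 2)) in Hge.
  assert (0 < e / 4 * (r / 2) ^ 2) by (apply Rmult_lt_0_compat; [lra | apply pow_lt; lra]).
  lra.
Qed.

(** Comparison with a parabola of the same value and the same zero slope at 0; [r] is both the
    radius and the lower bound for the second derivative. *)
Lemma tangent_growth (u v r : R) : f u v = 1 ->
  (forall b, Rabs b <= r -> r <= tan_hess u v b) ->
  forall b, Rabs b <= r -> 1 + r / 2 * b ^ 2 <= f (u + b * - Dy f u v) (v + b * Dx f u v).
Proof.
  intros Hf Hr b Hb.
  set (g s := f (u + s * - Dy f u v) (v + s * Dx f u v)).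
  set (g1 t := Dx f (u + t * - Dy f u v) (v + t * Dx f u v) * - Dy f u v
     + Dy f (u + t * - Dy f u v) (v + t * Dx f u v) * Dx f u v).
  assert (Hg : forall t, is_derive g t (g1 t)) by (intros; now apply is_derive_tangent).
  assert (Hg1 : forall t, is_derive g1 t (tan_hess u v t)) by (intros; now apply is_derive2_tangent).
  enough (0 <= g b - 1 - r / 2 * b ^ 2) by (unfold g in *; lra).
  apply (nonneg_of_second_derivative (fun t => g t - 1 - r / 2 * t ^ 2)
    (fun t => g1 t - r * t) (fun t => tan_hess u v t - r) r); trivial.
  - intros t _; auto_derive; [repeat split; eexists; apply Hg|].
    change (Derive (fun x : R => g x) t) with (Derive g t).
    rewrite (is_derive_unique _ _ _ (Hg t)); field.
  - intros t _; auto_derive; [repeat split; eexists; apply Hg1|].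
    change (Derive (fun x : R => g1 x) t) with (Derive g1 t).
    rewrite (is_derive_unique _ _ _ (Hg1 t)); field.
  - unfold g; rewrite !Rmult_0_l, !Rplus_0_r, Hf; ring.
  - unfold g1; rewrite !Rmult_0_l, !Rplus_0_r; ring.
  - intros t Ht; specialize (Hr t Ht); lra.
Qed.

(** Both sides have value 1 and slope 0 at [b = 0]; the factor [lam ^ 2] is what rescaling by [lam]
    does to a second derivative. *)
Lemma tangent_compare (u v u' v' lam r : R) : f u v = 1 -> f u' v' = 1 ->
  (forall b, Rabs b <= r -> lam ^ 2 * tan_hess u' v' (lam * b) <= tan_hess u v b) ->
  forall b, Rabs b <= r ->
    f (u' + lam * b * - Dy f u' v') (v' + lam * b * Dx f u' v')
    <= f (u + b * - Dy f u v) (v + b * Dx f u v).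
Proof.
  intros Hf Hf' Hr b Hb.
  set (g u v s := f (u + s * - Dy f u v) (v + s * Dx f u v)).
  set (g1 u v t := Dx f (u + t * - Dy f u v) (v + t * Dx f u v) * - Dy f u v
     + Dy f (u + t * - Dy f u v) (v + t * Dx f u v) * Dx f u v).
  assert (Hg : forall u v, f u v = 1 -> forall t, is_derive (g u v) t (g1 u v t))
    by (intros; now apply is_derive_tangent).
  assert (Hg1 : forall u v, f u v = 1 -> forall t, is_derive (g1 u v) t (tan_hess u v t))
    by (intros; now apply is_derive2_tangent).
  enough (0 <= g u v b - g u' v' (lam * b)) by (unfold g in *; lra).
  apply (nonneg_of_second_derivative (fun t => g u v t - g u' v' (lam * t))
    (fun t => g1 u v t - lam * g1 u' v' (lam * t))
    (fun t => tan_hess u v t - lam ^ 2 * tan_hess u' v' (lam * t)) r); trivial.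
  - intros t _; auto_derive; [repeat split; eexists; now apply Hg|].
    change (Derive (fun x : R => g u v x) t) with (Derive (g u v) t).
    change (Derive (fun x : R => g u' v' x) (lam * t)) with (Derive (g u' v') (lam * t)).
    rewrite (is_derive_unique _ _ _ (Hg u v Hf t)), (is_derive_unique _ _ _ (Hg u' v' Hf' _)); ring.
  - intros t _; auto_derive; [repeat split; eexists; now apply Hg1|].
    change (Derive (fun x : R => g1 u v x) t) with (Derive (g1 u v) t).
    change (Derive (fun x : R => g1 u' v' x) (lam * t)) with (Derive (g1 u' v') (lam * t)).
    rewrite (is_derive_unique _ _ _ (Hg1 u v Hf t)), (is_derive_unique _ _ _ (Hg1 u' v' Hf' _)); ring.
  - unfold g; rewrite !Rmult_0_r, !Rmult_0_l, !Rplus_0_r, Hf, Hf'; ring.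
  - unfold g1; rewrite !Rmult_0_r, !Rmult_0_l, !Rplus_0_r; ring.
  - intros t Ht; specialize (Hr t Ht); lra.
Qed.

(** At a centre off the sphere, a small enough square contains no point of the sphere, so the local
    condition is vacuous there. *)
Lemma sphere_local_to_uniform (P : R -> R -> R -> R -> R -> Prop) :
  (forall u v u' v' r s, s <= r -> P u v u' v' r -> P u v u' v' s) ->
  (forall a b, f a b = 1 -> exists r, 0 < r /\ forall u v u' v',
     f u v = 1 -> f u' v' = 1 -> Rabs (u - a) < r -> Rabs (v - b) < r ->
     Rabs (u' - a) < r -> Rabs (v' - b) < r -> P u v u' v' r) ->
  exists d, 0 < d /\ forall u v u' v', f u v = 1 -> f u' v' = 1 ->
    Rabs (u - u') < d -> Rabs (v - v') < d -> P u v u' v' d.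
Proof.
  intros Hanti Hloc; destruct norm_coercive as (K & _ & HK).
  apply (local_to_uniform (fun u v => f u v = 1) P K); trivial.
  - intros u v Huv; generalize (HK u v); rewrite Huv, Rmult_1_r; trivial.
  - intros a b; destruct (Req_dec (f a b) 1) as [Hab | Hab]; [now apply Hloc|].
    set (m := Rabs (f a b - 1)). set (M := f 1 0 + f 0 1).
    assert (Hm : 0 < m) by (apply Rabs_pos_lt; lra).
    assert (N1 := norm_nonneg 1 0); assert (N2 := norm_nonneg 0 1).
    (* In this square [f] differs from [f a b] by at most [m * M / (M + 1)], less than the gap [m]
       to 1. *)
    exists (m / (M + 1)); split; [apply Rdiv_lt_0_compat; unfold M; lra|].
    intros u v u' v' Huv _ Hu Hv _ _; exfalso.
    assert (E : m / (M + 1) * (M + 1) = m) by (field; unfold M; lra).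
    assert (Hle := norm_sub_le u v a b); assert (Hc := norm_le_coords (u - a) (v - b)).
    rewrite Huv, Rabs_minus_sym in Hle; fold m in Hle; unfold M in *.
    assert (Rabs (u - a) * f 1 0 <= m / (f 1 0 + f 0 1 + 1) * f 1 0) by (apply Rmult_le_compat_r; lra).
    assert (Rabs (v - b) * f 0 1 <= m / (f 1 0 + f 0 1 + 1) * f 0 1) by (apply Rmult_le_compat_r; lra).
    assert (0 < m / (f 1 0 + f 0 1 + 1)) by (apply Rdiv_lt_0_compat; lra).
    lra.
Qed.

Lemma gradient_uniformly_continuous (eta : R) : 0 < eta ->
  exists d, 0 < d /\ forall u v u' v', f u v = 1 -> f u' v' = 1 ->
    Rabs (u - u') < d -> Rabs (v - v') < d ->
    Rabs (Dx f u v - Dx f u' v') < eta /\ Rabs (Dy f u v - Dy f u' v') < eta.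
Proof.
  intros Heta.
  apply (sphere_local_to_uniform (fun u v u' v' _ =>
    Rabs (Dx f u v - Dx f u' v') < eta /\ Rabs (Dy f u v - Dy f u' v') < eta)); [easy|].
  intros a b Hab.
  destruct (f_C2 a b (norm_nonzero a b ltac:(lra))) as (_ & _ & _ & (Cx & _) & (Cy & _)).
  assert (He2 : 0 < eta / 2) by lra.
  destruct (Cx (mkposreal _ He2)) as [d1 H1]; destruct (Cy (mkposreal _ He2)) as [d2 H2]; simpl in *.
  exists (Rmin d1 d2); split; [apply Rmin_pos; apply cond_pos|].
  intros u v u' v' _ _ Hu Hv Hu' Hv'.
  assert (L1 := Rmin_l d1 d2); assert (L2 := Rmin_r d1 d2).
  generalize (H1 u v ltac:(lra) ltac:(lra)) (H1 u' v' ltac:(lra) ltac:(lra))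
    (H2 u v ltac:(lra) ltac:(lra)) (H2 u' v' ltac:(lra) ltac:(lra)).
  fold (Dx f u v) (Dx f u' v') (Dx f a b) (Dy f u v) (Dy f u' v') (Dy f a b).
  intros I1 I2 I3 I4; apply Rabs_lt_between in I1, I2, I3, I4.
  split; apply Rabs_def1; lra.
Qed.

(** The curvature hypothesis in analytic form; [tan_hess_pos] derives it from
    [positive_curvature]. *)
Context (f_curved : forall u v, f u v = 1 -> 0 < tan_hess u v 0).

Lemma tan_hess_uniform (lam : R) : 0 < lam < 1 ->
  exists r, 0 < r /\ forall u v u' v', f u v = 1 -> f u' v' = 1 ->
    Rabs (u - u') < r -> Rabs (v - v') < r ->
    forall b, Rabs b <= r ->
      r <= tan_hess u v b /\ lam ^ 2 * tan_hess u' v' (lam * b) <= tan_hess u v b.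
Proof.
  intros Hlam.
  apply (sphere_local_to_uniform (fun u v u' v' r => forall b, Rabs b <= r ->
      r <= tan_hess u v b /\ lam ^ 2 * tan_hess u' v' (lam * b) <= tan_hess u v b)).
  - intros u v u' v' r s Hsr HP b Hb; destruct (HP b ltac:(lra)); lra.
  - intros x y Hxy. set (c := tan_hess x y 0).
    assert (Hc : 0 < c) by now apply f_curved.
    assert (Hl2 : 0 < lam ^ 2 < 1) by nra.
    (* Both second derivatives will be within [e] of [c]. As [2 * e = c - lam ^ 2 * c], this gives
       [lam ^ 2 * (c + e) <= c - e], and also [c - e >= c / 2]. *)
    set (e := (1 - lam ^ 2) * c / 2).
    assert (He : 0 < e) by (unfold e; nra).
    destruct (tan_hess_near x y e Hxy He) as (r & Hr & Hnear).
    exists (Rmin (r / 2) (c / 2)); split; [apply Rmin_pos; lra|].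
    assert (L1 := Rmin_l (r / 2) (c / 2)); assert (L2 := Rmin_r (r / 2) (c / 2)).
    intros u v u' v' _ _ Hu Hv Hu' Hv' b Hb.
    assert (Hlb : Rabs (lam * b) < r).
    { rewrite Rabs_mult, (Rabs_pos_eq lam) by lra. generalize (Rabs_pos b); nra. }
    generalize (Hnear u v b ltac:(lra) ltac:(lra) ltac:(lra))
      (Hnear u' v' (lam * b) ltac:(lra) ltac:(lra) Hlb).
    fold c; intros H1 H2; apply Rabs_lt_between in H1, H2.
    assert (lam ^ 2 * tan_hess u' v' (lam * b) <= lam ^ 2 * (c + e)) by (apply Rmult_le_compat_l; lra).
    assert (0 < lam ^ 2 * c) by (apply Rmult_lt_0_compat; lra).
    assert (E : 2 * e = c - lam ^ 2 * c) by (unfold e; field).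
    assert (0 < (1 - lam ^ 2) * e) by (apply Rmult_lt_0_compat; lra).
    split; lra.
Qed.

(** * The contraction *)

Lemma tangent_uniformly_continuous (d : R) : 0 < d ->
  exists delta, 0 < delta /\ forall u v u' v', f u v = 1 -> f u' v' = 1 ->
    f (u' - u) (v' - v) < delta ->
    Rabs (u - u') < d /\ Rabs (v - v') < d /\
    f (- Dy f u' v' - - Dy f u v) (Dx f u' v' - Dx f u v) <= d.
Proof.
  intros Hd; destruct norm_coercive as (K & HK0 & HK).
  assert (N1 := norm_nonneg 1 0); assert (N2 := norm_nonneg 0 1).
  set (M := f 1 0 + f 0 1 + 1).
  assert (HM : 0 < M) by (unfold M; lra).
  destruct (gradient_uniformly_continuous (d / M)) as (d1 & Hd1 & Hg); [now apply Rdiv_lt_0_compat|].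
  exists (Rmin d d1 / K); split; [apply Rdiv_lt_0_compat; trivial; now apply Rmin_pos|].
  intros u v u' v' Hf Hf' Hlt.
  assert (HKd : K * f (u' - u) (v' - v) < Rmin d d1).
  { replace (Rmin d d1) with (K * (Rmin d d1 / K)) by (field; lra). now apply Rmult_lt_compat_l. }
  assert (L1 := Rmin_l d d1); assert (L2 := Rmin_r d d1).
  destruct (HK (u' - u) (v' - v)) as [Ku Kv]; rewrite Rabs_minus_sym in Ku, Kv.
  destruct (Hg u v u' v' Hf Hf' ltac:(lra) ltac:(lra)) as [Gx Gy].
  repeat split; try lra.
  eapply Rle_trans; [apply norm_le_coords|].
  replace (- Dy f u' v' - - Dy f u v) with (Dy f u v - Dy f u' v') by ring.
  rewrite (Rabs_minus_sym (Dx f u' v')).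
  assert (E : d / M * M = d) by (field; lra).
  assert (0 < d / M) by now apply Rdiv_lt_0_compat.
  assert (Rabs (Dy f u v - Dy f u' v') * f 1 0 <= d / M * f 1 0) by (apply Rmult_le_compat_r; lra).
  assert (Rabs (Dx f u v - Dx f u' v') * f 0 1 <= d / M * f 0 1) by (apply Rmult_le_compat_r; lra).
  unfold M in *; lra.
Qed.

(* Away from the ray through [(u, v)], convexity turns the quadratic growth of
   [f] along the tangent into a linear gain. *)
Lemma transversal_growth (u v r a b : R) : f u v = 1 -> 0 < r ->
  (forall t, Rabs t <= r -> r <= tan_hess u v t) -> r * Rabs a < Rabs b ->
  Rabs a + r ^ 2 / 2 * Rabs b <= f (a * u + b * - Dy f u v) (a * v + b * Dx f u v).
Proof.
  intros Hf Hr Hh Hab.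
  assert (Hgr := tangent_growth u v r Hf Hh).
  destruct (Req_dec a 0) as [-> | Ha].
  (* The growth at [r] against the triangle inequality bounds the norm of the tangent vector below
     by [r ^ 2 / 2]. *)
  - assert (H := Hgr r ltac:(rewrite Rabs_pos_eq; lra)).
    assert (H1 := f_triangle u v (r * - Dy f u v) (r * Dx f u v)).
    rewrite f_scal, Hf, (Rabs_pos_eq r) in H1 by lra.
    rewrite !Rmult_0_l, !Rplus_0_l, f_scal, Rabs_R0.
    assert (r ^ 2 / 2 <= f (- Dy f u v) (Dx f u v)) by (apply Rmult_le_reg_l with r; trivial; lra).
    generalize (Rabs_pos b); nra.
  - assert (Ha0 := Rabs_pos_lt a Ha).
    assert (Hb0 : 0 < Rabs b) by (assert (0 < r * Rabs a) by (now apply Rmult_lt_0_compat); lra).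
    set (F := f (a * u + b * - Dy f u v) (a * v + b * Dx f u v)).
    (* The convex combination of [a x] and [a x + b tau_x] with weight [mu] on the second is
       [a (x + t tau_x)] with [Rabs t = r], the edge of the range of [tangent_growth]. *)
    set (mu := r * Rabs a / Rabs b).
    assert (Hmu : mu * Rabs b = r * Rabs a) by (unfold mu; field; lra).
    assert (Hmu0 : 0 < mu) by (apply Rdiv_lt_0_compat; trivial; now apply Rmult_lt_0_compat).
    assert (Hmu1 : mu < 1) by (apply Rmult_lt_reg_r with (Rabs b); lra).
    set (t := mu * b / a).
    assert (Ht : Rabs t = r).
    { unfold t, Rdiv; rewrite !Rabs_mult, Rabs_inv, (Rabs_pos_eq mu), Hmu by lra; field; lra. }
    assert (H := Hgr t ltac:(lra)).
    rewrite <- (pow2_abs t), Ht in H.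
    assert (E : Rabs a * f (u + t * - Dy f u v) (v + t * Dx f u v) <= (1 - mu) * Rabs a + mu * F).
    { rewrite <- f_scal.
      replace (a * (u + t * - Dy f u v)) with
        ((1 - mu) * a * u + mu * (a * u + b * - Dy f u v)) by (unfold t; now field).
      replace (a * (v + t * Dx f u v)) with
        ((1 - mu) * a * v + mu * (a * v + b * Dx f u v)) by (unfold t; now field).
      eapply Rle_trans; [apply f_triangle|].
      rewrite !f_scal, Hf, Rabs_mult, (Rabs_pos_eq mu), (Rabs_pos_eq (1 - mu)) by lra.
      fold F; lra. }
    assert (E2 : Rabs a * (r ^ 3 / 2) <= mu * (F - Rabs a)).
    { assert (Rabs a * (1 + r / 2 * r ^ 2) <= Rabs a * f (u + t * - Dy f u v) (v + t * Dx f u v))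
        by (apply Rmult_le_compat_l; lra).
      lra. }
    enough (r ^ 2 / 2 * Rabs b <= F - Rabs a) by lra.
    apply Rmult_le_reg_l with mu; trivial.
    replace (mu * (r ^ 2 / 2 * Rabs b)) with (r ^ 2 / 2 * (mu * Rabs b)) by ring.
    rewrite Hmu; lra.
Qed.

Lemma tangent_map_contracts (lam : R) : 0 < lam < 1 ->
  exists delta, 0 < delta /\ forall u v u' v', f u v = 1 -> f u' v' = 1 ->
    f (u' - u) (v' - v) < delta -> forall a b,
    f (a * u' + lam * b * - Dy f u' v') (a * v' + lam * b * Dx f u' v')
    <= f (a * u + b * - Dy f u v) (a * v + b * Dx f u v).
Proof.
  intros Hlam.
  destruct (tan_hess_uniform lam Hlam) as (r & Hr & Hhess).
  (* The gain in the far case is [(1 - lam) * (r ^ 2 / 2) * Rabs b]. One half pays for moving the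
     tangent vector, by this choice of [e]; the other pays for moving the point, by the bound
     [r ^ 3 / 4] below and [r * Rabs a < Rabs b]. *)
  set (e := Rmin r ((1 - lam) * (r ^ 2 / 4))).
  assert (Hr2 : 0 < r ^ 2) by now apply pow_lt.
  assert (He : 0 < e) by (apply Rmin_pos; trivial; apply Rmult_lt_0_compat; lra).
  assert (L1 : e <= r) by apply Rmin_l. assert (L2 : e <= (1 - lam) * (r ^ 2 / 4)) by apply Rmin_r.
  destruct (tangent_uniformly_continuous e He) as (d & Hd & Hcont).
  assert (Hr3 : 0 < (1 - lam) * (r ^ 3 / 4)).
  { apply Rmult_lt_0_compat; [lra|]. assert (0 < r ^ 3) by now apply pow_lt. lra. }
  exists (Rmin d ((1 - lam) * (r ^ 3 / 4))); split; [now apply Rmin_pos|].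
  intros u v u' v' Hf Hf' Hlt a b.
  assert (L3 := Rmin_l d ((1 - lam) * (r ^ 3 / 4))); assert (L4 := Rmin_r d ((1 - lam) * (r ^ 3 / 4))).
  destruct (Hcont u v u' v' Hf Hf' ltac:(lra)) as (Hu & Hv & Htau).
  specialize (Hhess u v u' v' Hf Hf' ltac:(lra) ltac:(lra)).
  destruct (Rle_lt_dec (Rabs b) (r * Rabs a)) as [Hnear | Hfar].
  - destruct (Req_dec a 0) as [-> | Ha].
    + rewrite Rabs_R0, Rmult_0_r in Hnear.
      assert (b = 0) as -> by (apply Rabs_eq_0; generalize (Rabs_pos b); lra).
      right; f_equal; ring.
    + assert (Hba : Rabs (b / a) <= r).
      { unfold Rdiv; rewrite Rabs_mult, Rabs_inv.
        assert (Ha0 := Rabs_pos_lt a Ha).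
        apply Rmult_le_reg_r with (Rabs a); trivial.
        rewrite Rmult_assoc, Rinv_l; lra. }
      assert (H := tangent_compare u v u' v' lam r Hf Hf' (fun t Ht => proj2 (Hhess t Ht)) (b / a) Hba).
      apply (Rmult_le_compat_l (Rabs a)) in H; [|apply Rabs_pos].
      rewrite <- !f_scal in H.
      replace (a * u' + lam * b * - Dy f u' v') with (a * (u' + lam * (b / a) * - Dy f u' v')) by now field.
      replace (a * v' + lam * b * Dx f u' v') with (a * (v' + lam * (b / a) * Dx f u' v')) by now field.
      replace (a * u + b * - Dy f u v) with (a * (u + b / a * - Dy f u v)) by now field.
      replace (a * v + b * Dx f u v) with (a * (v + b / a * Dx f u v)) by now field.
      exact H.
  - assert (HG := transversal_growth u v r a b Hf Hr (fun t Ht => proj1 (Hhess t Ht)) Hfar).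
    set (F := f (a * u + b * - Dy f u v) (a * v + b * Dx f u v)) in *.
    (* Convexity: [a x + lam b tau_x] lies between [a x] and [a x + b tau_x]. *)
    assert (H1 : f (a * u + lam * b * - Dy f u v) (a * v + lam * b * Dx f u v)
                 <= (1 - lam) * Rabs a + lam * F).
    { replace (a * u + lam * b * - Dy f u v) with
        ((1 - lam) * a * u + lam * (a * u + b * - Dy f u v)) by ring.
      replace (a * v + lam * b * Dx f u v) with
        ((1 - lam) * a * v + lam * (a * v + b * Dx f u v)) by ring.
      eapply Rle_trans; [apply f_triangle|].
      rewrite !f_scal, Hf, Rabs_mult, (Rabs_pos_eq lam), (Rabs_pos_eq (1 - lam)) by lra.
      fold F; lra. }
    assert (H2 : f (a * u' + lam * b * - Dy f u' v') (a * v' + lam * b * Dx f u' v')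
      <= f (a * u + lam * b * - Dy f u v) (a * v + lam * b * Dx f u v)
         + (Rabs a * f (u' - u) (v' - v)
            + lam * Rabs b * f (- Dy f u' v' - - Dy f u v) (Dx f u' v' - Dx f u v))).
    { replace (a * u' + lam * b * - Dy f u' v') with (a * u + lam * b * - Dy f u v +
        (a * (u' - u) + lam * b * (- Dy f u' v' - - Dy f u v))) by ring.
      replace (a * v' + lam * b * Dx f u' v') with (a * v + lam * b * Dx f u v +
        (a * (v' - v) + lam * b * (Dx f u' v' - Dx f u v))) by ring.
      eapply Rle_trans; [apply f_triangle|]; apply Rplus_le_compat_l.
      eapply Rle_trans; [apply f_triangle|].
      rewrite !f_scal, Rabs_mult, (Rabs_pos_eq lam); lra. }
    assert (Ha := Rabs_pos a); assert (Hb := Rabs_pos b).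
    assert (H3 : Rabs a * f (u' - u) (v' - v) <= Rabs b * ((1 - lam) * (r ^ 2 / 4))).
    { apply Rle_trans with (Rabs a * ((1 - lam) * (r ^ 3 / 4))); [apply Rmult_le_compat_l; lra|].
      replace (Rabs a * ((1 - lam) * (r ^ 3 / 4))) with
        (r * Rabs a * ((1 - lam) * (r ^ 2 / 4))) by field.
      apply Rmult_le_compat_r; lra. }
    assert (H4 : lam * Rabs b * f (- Dy f u' v' - - Dy f u v) (Dx f u' v' - Dx f u v)
      <= Rabs b * ((1 - lam) * (r ^ 2 / 4))).
    { apply Rle_trans with (lam * Rabs b * ((1 - lam) * (r ^ 2 / 4)));
        [apply Rmult_le_compat_l; [apply Rmult_le_pos|]; lra|].
      apply Rmult_le_compat_r; [lra|]. nra. }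
    assert (H5 : (1 - lam) * (r ^ 2 / 2 * Rabs b) <= (1 - lam) * (F - Rabs a))
      by (apply Rmult_le_compat_l; lra).
    lra.
Qed.

(** * The linear map and its distance to the identity *)

Definition tangent_map (lam u v u' v' : R) (z : R2) : R2 :=
  let a := Dx f u v * fst z + Dy f u v * snd z in
  let b := u * snd z - v * fst z in
  (a * u' + lam * b * - Dy f u' v', a * v' + lam * b * Dx f u' v').

(** By Euler's identity the frame [x, tau_x] has determinant 1, so Cramer's rule gives the
    coordinates used in [tangent_map]. *)
Lemma tangent_decomposition (u v p q : R) : f u v = 1 ->
  p = (Dx f u v * p + Dy f u v * q) * u + (u * q - v * p) * - Dy f u v /\
  q = (Dx f u v * p + Dy f u v * q) * v + (u * q - v * p) * Dx f u v.
Proof.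
  intros H; assert (E := euler u v (norm_nonzero u v ltac:(lra))); rewrite H in E.
  split.
  - transitivity (p * (Dx f u v * u + Dy f u v * v)); [rewrite E; ring | ring].
  - transitivity (q * (Dx f u v * u + Dy f u v * v)); [rewrite E; ring | ring].
Qed.

Lemma tangent_map_linear (lam u v u' v' : R) : is_linear (tangent_map lam u v u' v').
Proof.
  apply (is_linear_ext (fun z : R2 =>
    (plus (scal (Dx f u v * u' + lam * v * Dy f u' v') (fst z))
          (scal (Dy f u v * u' - lam * u * Dy f u' v') (snd z)),
     plus (scal (Dx f u v * v' - lam * v * Dx f u' v') (fst z))
          (scal (Dy f u v * v' + lam * u * Dx f u' v') (snd z))) : R2)).
  - intros [p q]; unfold tangent_map; simpl; unfold plus, scal; simpl; unfold mult; simpl.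
    f_equal; ring.
  - assert (Hcoord : forall (A B : R), is_linear (K := R_AbsRing) (U := R2) (V := R_NormedModule)
      (fun z : R2 => plus (scal A (fst z)) (scal B (snd z)))).
    { intros A B.
      apply (is_linear_comp (U := R2) (V := R2) (W := R_NormedModule)
        (fun z : R2 => (scal A (fst z), scal B (snd z)) : R2) (fun w => plus (fst w) (snd w)));
        [|apply is_linear_plus].
      apply (is_linear_prod (T := R2) (U := R_NormedModule) (V := R_NormedModule)).
      - apply (is_linear_comp (U := R2) (V := R_NormedModule) (W := R_NormedModule) (fun z => fst z));
          [apply is_linear_fst | exact (is_linear_scal_r (V := R_NormedModule) _ Rmult_comm)].
      - apply (is_linear_comp (U := R2) (V := R_NormedModule) (W := R_NormedModule) (fun z => snd z));
          [apply is_linear_snd | exact (is_linear_scal_r (V := R_NormedModule) _ Rmult_comm)]. }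
    apply (is_linear_prod (T := R2) (U := R_NormedModule) (V := R_NormedModule)); apply Hcoord.
Qed.

(** The image has coordinates [a] and [lam * b] in the frame at [(u', v')], which the map with
    points exchanged and factor [/ lam] undoes. *)
Lemma tangent_map_inverse (lam u v u' v' : R) (z : R2) : lam <> 0 -> f u v = 1 -> f u' v' = 1 ->
  tangent_map (/ lam) u' v' u v (tangent_map lam u v u' v' z) = z.
Proof.
  intros Hlam H H'; destruct z as [p q].
  assert (E' := euler u' v' (norm_nonzero u' v' ltac:(lra))); rewrite H' in E'.
  destruct (tangent_decomposition u v p q H) as [Ep Eq].
  unfold tangent_map; simpl.
  set (a := Dx f u v * p + Dy f u v * q) in *; set (b := u * q - v * p) in *.
  replace (Dx f u' v' * (a * u' + lam * b * - Dy f u' v') + Dy f u' v' * (a * v' + lam * b * Dx f u' v'))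
    with (a * (Dx f u' v' * u' + Dy f u' v' * v')) by ring.
  replace (u' * (a * v' + lam * b * Dx f u' v') - v' * (a * u' + lam * b * - Dy f u' v'))
    with (lam * b * (Dx f u' v' * u' + Dy f u' v' * v')) by ring.
  rewrite E', !Rmult_1_r, <- (Rmult_assoc (/ lam)), Rinv_l, Rmult_1_l by trivial.
  now rewrite <- Ep, <- Eq.
Qed.

Lemma tangent_map_point (lam u v u' v' : R) : f u v = 1 ->
  tangent_map lam u v u' v' (u, v) = (u', v').
Proof.
  intros H; assert (E := euler u v (norm_nonzero u v ltac:(lra))); rewrite H in E.
  unfold tangent_map; simpl; rewrite E; f_equal; ring.
Qed.

(** With [lam = 1 - s], [T z - z] is [a (y - x) + (1 - s) b (tau_y - tau_x) - s b tau_x], and each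
    term is allotted [eps / 3]. [lam] depends on [eps] alone and is fixed before [delta], as
    [tangent_map_contracts] requires. *)
Lemma tangent_map_near_identity (eps : R) : 0 < eps ->
  exists lam, 0 < lam < 1 /\
  exists delta, 0 < delta /\ forall u v u' v', f u v = 1 -> f u' v' = 1 ->
    f (u' - u) (v' - v) < delta -> forall p q,
    f (fst (tangent_map lam u v u' v' (p, q)) - p) (snd (tangent_map lam u v u' v' (p, q)) - q)
    <= eps * f p q.
Proof.
  intros Heps; destruct norm_coercive as (K & HK0 & HK).
  assert (N1 := norm_nonneg 1 0); assert (N2 := norm_nonneg 0 1).
  (* [L] will bound [b] relative to [f p q], and [B] the norm of a tangent vector; the [1 / 2] in
     [s] keeps [lam] positive. *)
  set (L := 2 * K ^ 2). assert (HL : 0 < L) by (unfold L; generalize (pow_lt K 2 HK0); lra).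
  set (B := 2 * f 1 0 * f 0 1).
  assert (HB : 0 <= B) by (unfold B; nra).
  set (s := Rmin (1 / 2) (eps / (3 * L * (B + 1)))).
  assert (HLB : 0 < 3 * L * (B + 1)) by (apply Rmult_lt_0_compat; lra).
  assert (Hs : 0 < s) by (apply Rmin_pos; [lra | now apply Rdiv_lt_0_compat]).
  assert (Hs1 : s <= 1 / 2) by apply Rmin_l.
  assert (HsB : L * (s * B) <= eps / 3).
  { apply Rle_trans with (L * (B + 1) * (eps / (3 * L * (B + 1)))); [|right; field; lra].
    apply Rle_trans with (L * (B + 1) * s).
    - assert (0 < L * s) by (now apply Rmult_lt_0_compat). lra.
    - apply Rmult_le_compat_l; [left; apply Rmult_lt_0_compat; lra | apply Rmin_r]. }
  set (eta := eps / (3 * L)).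
  assert (Heta : 0 < eta) by (apply Rdiv_lt_0_compat; lra).
  assert (HLeta : L * eta = eps / 3) by (unfold eta; field; lra).
  exists (1 - s); split; [lra|].
  destruct (tangent_uniformly_continuous eta Heta) as (d & Hd & Hcont).
  exists (Rmin d (eps / 3)); split; [apply Rmin_pos; lra|].
  assert (L1 := Rmin_l d (eps / 3)); assert (L2 := Rmin_r d (eps / 3)).
  intros u v u' v' Hf Hf' Hlt p q.
  destruct (Hcont u v u' v' Hf Hf' ltac:(lra)) as (_ & _ & Htau).
  assert (H0 := norm_nonzero u v ltac:(lra)).
  assert (Ha := gradient_le u v p q H0).
  destruct (tangent_decomposition u v p q Hf) as [Ep Eq].
  unfold tangent_map; simpl.
  set (b := u * q - v * p) in *.
  assert (Hb : Rabs b <= L * f p q).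
  { destruct (HK u v) as [Ku Kv]; destruct (HK p q) as [Kp Kq]; rewrite Hf in Ku, Kv.
    unfold b, Rminus; eapply Rle_trans; [apply Rabs_triang|]; rewrite Rabs_Ropp, !Rabs_mult.
    assert (Rabs u * Rabs q <= K * 1 * (K * f p q)) by (apply Rmult_le_compat; trivial; apply Rabs_pos).
    assert (Rabs v * Rabs p <= K * 1 * (K * f p q)) by (apply Rmult_le_compat; trivial; apply Rabs_pos).
    unfold L; lra. }
  set (a := Dx f u v * p + Dy f u v * q) in *.
  rewrite Ep at 1; rewrite Eq at 1.
  replace (a * u' + (1 - s) * b * - Dy f u' v' - (a * u + b * - Dy f u v)) with
    (a * (u' - u) + (b * ((1 - s) * (- Dy f u' v' - - Dy f u v)) + b * (- s * - Dy f u v))) by ring.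
  replace (a * v' + (1 - s) * b * Dx f u' v' - (a * v + b * Dx f u v)) with
    (a * (v' - v) + (b * ((1 - s) * (Dx f u' v' - Dx f u v)) + b * (- s * Dx f u v))) by ring.
  assert (Htan : f (- Dy f u v) (Dx f u v) <= B).
  { eapply Rle_trans; [apply norm_le_coords|]; rewrite Rabs_Ropp.
    generalize (Dx_norm_le u v H0) (Dy_norm_le u v H0); intros Gx Gy; unfold B.
    apply (Rmult_le_compat_r (f 0 1)) in Gx; trivial.
    apply (Rmult_le_compat_r (f 1 0)) in Gy; trivial. lra. }
  eapply Rle_trans; [apply f_triangle|].
  eapply Rle_trans; [apply Rplus_le_compat_l, f_triangle|].
  rewrite !f_scal, Rabs_Ropp, (Rabs_pos_eq s), (Rabs_pos_eq (1 - s)) by lra.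
  assert (Hz := norm_nonneg p q).
  assert (Hx := norm_nonneg (u' - u) (v' - v)).
  assert (Ht := norm_nonneg (- Dy f u' v' - - Dy f u v) (Dx f u' v' - Dx f u v)).
  assert (Ht0 := norm_nonneg (- Dy f u v) (Dx f u v)).
  assert (P1 : Rabs a * f (u' - u) (v' - v) <= f p q * (eps / 3))
    by (apply Rmult_le_compat; trivial; [apply Rabs_pos | lra]).
  assert (P2 : Rabs b * ((1 - s) * f (- Dy f u' v' - - Dy f u v) (Dx f u' v' - Dx f u v))
    <= L * f p q * eta).
  { apply Rmult_le_compat; trivial; [apply Rabs_pos | apply Rmult_le_pos; lra | nra]. }
  assert (P3 : Rabs b * (s * f (- Dy f u v) (Dx f u v)) <= L * f p q * (s * B)).
  { apply Rmult_le_compat; trivial; [apply Rabs_pos | apply Rmult_le_pos; lra | nra]. }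
  assert (P4 : f p q * (L * (s * B)) <= f p q * (eps / 3)) by (apply Rmult_le_compat_l; lra).
  replace (L * f p q * eta) with (f p q * (L * eta)) in P2 by ring.
  rewrite HLeta in P2; lra.
Qed.

End PlanarNorm.

(** * Back to norms on [R2] *)

Lemma is_norm_coords (N : R2 -> R) (f := fun a b : R => N (a, b)) : is_norm N ->
  (forall u v u' v', f (u + u') (v + v') <= f u v + f u' v') /\
  (forall a u v, f (a * u) (a * v) = Rabs a * f u v) /\
  (forall u v, f u v = 0 -> u = 0 /\ v = 0).
Proof.
  intros [N_tri N_scal N_def]; split; [|split].
  - intros u v u' v'; apply (N_tri (u, v) (u', v')).
  - intros a u v; apply (N_scal a (u, v)).
  - intros u v E; apply N_def in E; now injection E.
Qed.

(** The value is nonnegative; were it zero, [hess_tangent_nonzero] would force the acceleration of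
    the arc-length curve to vanish, giving curvature 0. *)
Lemma tan_hess_pos (N : R2 -> R) (N_norm : is_norm N) (N_C2 : C2_off_zero N)
    (N_curv : positive_curvature (unit_sphere N)) (u v : R) :
  N (u, v) = 1 -> 0 < tan_hess (fun a b => N (a, b)) u v 0.
Proof.
  set (f := fun a b : R => N (a, b)); change (N (u, v)) with (f u v); intros Huv.
  destruct (is_norm_coords N N_norm) as (f_tri & f_scal & f_def); fold f in f_tri, f_scal, f_def.
  assert (f_C2 : forall u v, (u, v) <> (0, 0) -> ex_diff_n f 2 u v) by exact N_C2.
  destruct (hess_tangent_nonneg f f_tri f_scal f_C2 u v Huv) as [H | H]; trivial; exfalso.
  destruct (arc_length_exists f f_tri f_scal f_def f_C2)
    as (p & q & p1 & q1 & p2 & q2 & Hp & Hq & Hp1 & Hq1 & Hf & Hl & Hsurj).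
  destruct (Hsurj u v Huv) as (t & <- & <-).
  rewrite tan_hess_0 in H; symmetry in H; revert H.
  apply (hess_tangent_nonzero f f_scal f_C2 p q p1 q1 p2 q2); trivial.
  intros E; injection E as Ep Eq.
  assert (Hk : 0 < norm ((p2 t, q2 t) : R2)).
  { apply (N_curv (p t, q t)); [exact Huv|].
    exists (fun t => (p t, q t)), (fun t => (p1 t, q1 t)), (fun t => (p2 t, q2 t)), t.
    split; [|now split].
    split; [exact Hf|]. split; [intros [a b] Hab; destruct (Hsurj a b Hab) as (s & <- & <-); now exists s|].
    split; [intros s; now apply is_derive_pair|]. split; [|intros s; now apply is_derive_pair].
    intros s; change (sqrt (Rabs (p1 s) ^ 2 + Rabs (q1 s) ^ 2) = 1).
    rewrite !pow2_abs, Hl; apply sqrt_1. }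
  rewrite Ep, Eq in Hk; change (0 < norm (zero : R2)) in Hk; rewrite norm_zero in Hk; lra.
Qed.

Lemma opnorm_le (N : R2 -> R) (T : R2 -> R2) (c : R) :
  0 <= c -> (forall z, N (T z) <= c * N z) -> Rbar_le (opnorm N T) c.
Proof.
  intros Hc HT; apply (Lub_Rbar_correct (fun r => exists x : R2, N x <= 1 /\ r = N (T x))).
  intros r (z & Hz & ->); apply Rle_trans with (c * N z); [apply HT|].
  rewrite <- (Rmult_1_r c) at 2; now apply Rmult_le_compat_l.
Qed.

Theorem theorem4p2 (N : R2 -> R) (N_norm : is_norm N) (N_C2 : C2_off_zero N)
    (N_curv : positive_curvature (unit_sphere N)) :
  uniformly_micro_semitransitive N.
Proof.
  assert (f_curved := tan_hess_pos N N_norm N_C2 N_curv).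
  set (f := fun a b : R => N (a, b)) in *.
  destruct (is_norm_coords N N_norm) as (f_tri & f_scal & f_def); fold f in f_tri, f_scal, f_def.
  assert (f_C2 : forall u v, (u, v) <> (0, 0) -> ex_diff_n f 2 u v) by exact N_C2.
  intros eps Heps.
  (* The operator norm is a supremum, so a bound by [eps / 2] secures the strict inequality. *)
  destruct (tangent_map_near_identity f f_tri f_scal f_def f_C2 (eps / 2) ltac:(lra))
    as (lam & Hlam & d1 & Hd1 & Hnear).
  destruct (tangent_map_contracts f f_tri f_scal f_def f_C2 f_curved lam Hlam) as (d2 & Hd2 & Hcontr).
  exists (Rmin d1 d2); split; [now apply Rmin_pos|].
  intros [u v] [u' v'] Hx Hy Hxy; change (f u v = 1) in Hx; change (f u' v' = 1) in Hy.
  change (f (u - u') (v - v') < Rmin d1 d2) in Hxy.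
  rewrite <- (norm_opp f f_scal) in Hxy.
  replace (- (u - u')) with (u' - u) in Hxy by ring; replace (- (v - v')) with (v' - v) in Hxy by ring.
  assert (L1 := Rmin_l d1 d2); assert (L2 := Rmin_r d1 d2).
  exists (tangent_map f lam u v u' v'); split; [|split; [|split]].
  - split; [apply tangent_map_linear|].
    exists (tangent_map f (/ lam) u' v' u v); split; [apply tangent_map_linear|]; split; intros z.
    + apply (tangent_map_inverse f f_scal f_C2); trivial; lra.
    (* Reading [lam] as the inverse of [/ lam] turns the other composite into the same lemma. *)
    + rewrite <- (Rinv_inv lam) at 1.
      apply (tangent_map_inverse f f_scal f_C2); trivial; apply Rinv_neq_0_compat; lra.
  - apply opnorm_le; [lra|]; intros [p q]; rewrite Rmult_1_l.
    destruct (tangent_decomposition f f_scal f_C2 u v p q Hx) as [Ep Eq].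
    (* Expanding [(p, q)] in the frame at [x] turns the goal into the inequality [Hcontr]. *)
    change (N (p, q)) with (f p q); rewrite (f_equal2 f Ep Eq).
    apply (Hcontr u v u' v'); trivial; lra.
  - now apply (tangent_map_point f f_scal f_C2).
  - apply Rbar_le_lt_trans with (Finite (eps / 2)); [|simpl; lra].
    apply opnorm_le; [lra|]; intros [p q].
    apply (Hnear u v u' v'); trivial; lra.
Qed.
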